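(* Let $(\Omega,\Sigma,\lambda)$ be a probability space, $L_1=L_1(\Omega,\Sigma,\lambda)$, and let $X\subset L_1$ be a closed subspace. If, for some $r>\frac12$, $rB(L_1)\subset C_X$, then $X=L_1$.
   Context: Scalars are real or complex. $B(W)$ denotes the closed unit ball of a Banach space $W$. For a closed subspace $X\subset L_1$, $C_X$ denotes the closure of the ball $B(X)$ (unit ball for the $L_1$-norm) in $L_1$ with respect to the topology of convergence in measure (the $L_0$-topology). *)

(* Defs.v *)
Set Warnings "-notation-overridden,-ambiguous-paths,-redundant-canonical-projection".
From HB Require Import structures.
From mathcomp Require Import all_boot all_order all_algebra.
From mathcomp Require Import complex.
From mathcomp Require Import all_classical all_reals all_analysis.
From mathcomp Require Import measurable_realfun.

Set Implicit Arguments.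
Unset Strict Implicit.
Unset Printing Implicit Defensive.
Import Order.TTheory GRing.Theory Num.Theory.
Import numFieldNormedType.Exports.

Local Open Scope classical_set_scope.
Local Open Scope ring_scope.

Variant scalar_kind := RealScalars | ComplexScalars.

Definition scalar (R : realType) (k : scalar_kind) : numFieldType :=
  match k with
  | RealScalars => R
  | ComplexScalars => R[i]
  end.

(* The absolute value, with values in R also for complex scalars (the
   mathcomp norm of R[i] takes its values in R[i]). *)
Definition modulus {R : realType} {k : scalar_kind} : scalar R k -> R :=
  match k return scalar R k -> R with
  | RealScalars => fun x => `|x|
  | ComplexScalars => fun z => Normc.normc z
  end.

Definition of_real {R : realType} (k : scalar_kind) (r : R) : scalar R k :=
  match k return scalar R k with
  | RealScalars => r
  | ComplexScalars => (r%:C)%C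
  end.

Definition measurable_scalar_fun {R : realType} {d : measure_display}
    {T : measurableType d} {k : scalar_kind} : (T -> scalar R k) -> Prop :=
  match k return (T -> scalar R k) -> Prop with
  | RealScalars => fun f => measurable_fun [set: T] (f : T -> R)
  | ComplexScalars => fun f =>
      measurable_fun [set: T] (fun x => complex.Re (f x) : R) /\
      measurable_fun [set: T] (fun x => complex.Im (f x) : R)
  end.

Section scalar_theory.
Context {R : realType} {k : scalar_kind}.
Implicit Types x y : scalar R k.

Lemma modulus_ge0 x : 0 <= modulus x.
Proof. by case: k x => [x|[a b]] /=; rewrite ?sqrtr_ge0. Qed.

Lemma modulus0 : modulus (0 : scalar R k) = 0.
Proof. by case: k => /=; [exact: normr0|exact: Normc.normc0]. Qed.

Lemma modulusN x : modulus (- x) = modulus x.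
Proof. by case: k x => /= x; [exact: normrN|exact: normcN]. Qed.

Lemma modulusM x y : modulus (x * y) = modulus x * modulus y.
Proof. by case: k x y => /= x y; [exact: normrM|exact: Normc.normcM]. Qed.

Lemma ler_modulusD x y : modulus (x + y) <= modulus x + modulus y.
Proof. by case: k x y => /= x y; [exact: ler_normD|exact: le_normcD]. Qed.

Context {d : measure_display} {T : measurableType d}.
Implicit Types f g : T -> scalar R k.

Lemma measurable_scalar_cst (c : scalar R k) :
  measurable_scalar_fun (fun _ : T => c).
Proof. by case: k c => /= c; [|split]; exact: measurable_cst. Qed.

Lemma measurable_scalarD f g : measurable_scalar_fun f ->
  measurable_scalar_fun g -> measurable_scalar_fun (fun t => f t + g t).
Proof.
case: k f g => /= f g; first exact: (@measurable_funD _ T R).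
move=> [rf jf] [rg jg]; split.
  by under eq_fun do rewrite raddfD/=; exact: measurable_funD.
by under eq_fun do rewrite raddfD/=; exact: measurable_funD.
Qed.

Lemma measurable_scalarM f g : measurable_scalar_fun f ->
  measurable_scalar_fun g -> measurable_scalar_fun (fun t => f t * g t).
Proof.
case: k f g => /= f g; first exact: (@measurable_funM _ T R).
move=> [rf jf] [rg jg]; split.
  rewrite [X in measurable_fun _ X](_ : _ = fun x : T =>
    complex.Re (f x) * complex.Re (g x) - complex.Im (f x) * complex.Im (g x)).
    by apply: measurable_funB; exact: measurable_funM.
  by apply/funext => x; case: (f x) => ? ?; case: (g x).
rewrite [X in measurable_fun _ X](_ : _ = fun x : T =>
  complex.Re (f x) * complex.Im (g x) + complex.Im (f x) * complex.Re (g x)).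
  by apply: measurable_funD; exact: measurable_funM.
by apply/funext => x; case: (f x) => ? ?; case: (g x).
Qed.

Lemma measurable_modulus f : measurable_scalar_fun f ->
  measurable_fun [set: T] (fun t => modulus (f t)).
Proof.
case: k f => /= f; first by move=> mf; exact: measurableT_comp.
move=> [rf jf].
rewrite [X in measurable_fun _ X](_ : _ = fun x : T =>
  Num.sqrt (complex.Re (f x) ^+ 2 + complex.Im (f x) ^+ 2)).
  apply: measurableT_comp.
    by apply: continuous_measurable_fun; exact: sqrt_continuous.
  by apply: measurable_funD; exact: measurable_funX.
by apply/funext => x; case: (f x).
Qed.

End scalar_theory.

Section L1.
Context {R : realType} {d : measure_display} {T : measurableType d}.
Variables (k : scalar_kind) (P : probability T R).
Local Notation K := (scalar R k).

Definition norm1 (f : T -> K) : \bar R :=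
  ('N[P]_1[EFin \o (modulus \o f)])%E.

Definition L1fun : {pred T -> K} :=
  mem [set f | measurable_scalar_fun f /\ (norm1 f < +oo)%E].

Lemma norm1_ge0 f : (0 <= norm1 f)%E. Proof. exact: Lnorm_ge0. Qed.

Lemma norm1E f : norm1 f = (\int[P]_x (modulus (f x))%:E)%E.
Proof.
rewrite /norm1 Lnorm1; apply: eq_integral => x _.
by rewrite gee0_abs// lee_fin modulus_ge0.
Qed.

Lemma norm10 : norm1 0 = 0%E.
Proof.
by rewrite norm1E; under eq_integral do rewrite modulus0; rewrite integral0.
Qed.

Lemma norm1N f : norm1 (- f) = norm1 f.
Proof. by rewrite !norm1E; apply: eq_integral => x _; rewrite modulusN. Qed.

Lemma norm1D (f g : T -> K) :
  measurable_scalar_fun f -> measurable_scalar_fun g ->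
  (norm1 (f + g)%R <= norm1 f + norm1 g)%E.
Proof.
move=> mf mg; rewrite !norm1E -ge0_integralD//; last 4 first.
- by move=> x _; rewrite lee_fin modulus_ge0.
- by apply/measurable_EFinP; exact: measurable_modulus.
- by move=> x _; rewrite lee_fin modulus_ge0.
- by apply/measurable_EFinP; exact: measurable_modulus.
apply: ge0_le_integral => //.
- by move=> x _; rewrite lee_fin modulus_ge0.
- apply/measurable_EFinP/measurable_modulus.
  exact: (measurable_scalarD mf mg).
- apply: emeasurable_funD; apply/measurable_EFinP; exact: measurable_modulus.
- by move=> x _; rewrite -EFinD lee_fin ler_modulusD.
Qed.

Lemma norm1Z (a : K) (f : T -> K) : measurable_scalar_fun f ->
  norm1 (a *: f) = ((modulus a)%:E * norm1 f)%E.
Proof.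
move=> mf; rewrite !norm1E -ge0_integralZl//.
- by apply: eq_integral => x _; rewrite -EFinM -modulusM.
- by apply/measurable_EFinP; exact: measurable_modulus.
- by move=> x _; rewrite lee_fin modulus_ge0.
- by rewrite lee_fin modulus_ge0.
Qed.

Lemma L1fun_submod_closed : submod_closed L1fun.
Proof.
split.
  rewrite inE; split; first exact: measurable_scalar_cst.
  by rewrite norm10.
move=> a f g; rewrite !inE => -[mf f1] [mg g1].
have maf : measurable_scalar_fun (a *: f).
  exact: measurable_scalarM (measurable_scalar_cst a) mf.
split; first exact: measurable_scalarD.
apply: le_lt_trans (norm1D maf mg) _.
rewrite norm1Z// lte_add_pinfty// lte_mul_pinfty// lee_fin.
exact: modulus_ge0.
Qed.

HB.instance Definition _ := GRing.isSubmodClosed.Build _ _ L1fun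
  L1fun_submod_closed.

(* Elements are functions, not classes modulo almost everywhere equality, as
   for LfunType; [closed_ae_eq] below shows that sets that are closed for the
   L_1-seminorm are saturated for almost everywhere equality. *)
Record L1 : Type := MkL1 { L1val :> T -> K ; L1valP : L1val \in L1fun }.

HB.instance Definition _ := [isSub for L1val].
HB.instance Definition _ := [Choice of L1 by <:].
HB.instance Definition _ := [SubChoice_isSubLmodule of L1 by <:].


Definition L1norm (f : L1) : R := fine (norm1 f).

Lemma L1normE f : (L1norm f)%:E = norm1 f.
Proof.
rewrite /L1norm fineK// ge0_fin_numE ?norm1_ge0//.
by have := L1valP f; rewrite inE => -[].
Qed.

Lemma measurable_L1 (f : L1) : measurable_scalar_fun (f : T -> K).
Proof. by have := L1valP f; rewrite inE => -[]. Qed.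

Lemma ler_L1normD (f g : L1) : L1norm (f + g) <= L1norm f + L1norm g.
Proof. by rewrite -lee_fin EFinD !L1normE norm1D//; exact: measurable_L1. Qed.

Lemma L1normN (f : L1) : L1norm (- f) = L1norm f.
Proof. by apply: EFin_inj; rewrite !L1normE norm1N. Qed.

Lemma L1norm0 : L1norm 0 = 0.
Proof. by apply: EFin_inj; rewrite L1normE norm10. Qed.

Definition L1_ball (f : L1) (e : R) : set L1 := [set g | L1norm (f - g) < e].

Lemma L1_ball_center f (e : R) : 0 < e -> L1_ball f e f.
Proof. by rewrite /L1_ball/= subrr L1norm0. Qed.

Lemma L1_ball_sym f g (e : R) : L1_ball f e g -> L1_ball g e f.
Proof. by rewrite /L1_ball/= -[g - f]opprB L1normN. Qed.

Lemma L1_ball_triangle f g h (e1 e2 : R) :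
  L1_ball f e1 g -> L1_ball g e2 h -> L1_ball f (e1 + e2) h.
Proof.
rewrite /L1_ball/= => fg gh; rewrite -[f](subrK g) -addrA.
by apply: le_lt_trans (ler_L1normD _ _) _; rewrite ltrD.
Qed.

HB.instance Definition _ := hasNbhs.Build L1 (nbhs_ (entourage_ L1_ball)).
HB.instance Definition _ := @Nbhs_isPseudoMetric.Build R L1
  (entourage_ L1_ball) erefl L1_ball
  L1_ball_center L1_ball_sym L1_ball_triangle erefl.

Lemma closed_ae_eq (X : set L1) (f g : L1) : closed X ->
  {ae P, forall x, f x = g x} -> X f -> X g.
Proof.
move=> cX fg Xf; apply: cX => A /nbhs_ballP[e /= e0 eA].
exists f; split => //; apply: eA.
change (L1norm (g - f) < e); suff -> : L1norm (g - f) = 0 by [].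
apply: EFin_inj; rewrite L1normE norm1E.
rewrite (ae_eq_integral (cst 0%E)) ?integral0//.
- apply/measurable_EFinP/measurable_modulus; exact: (measurable_L1 (g - f)).
- apply: filterS fg => x fgx _.
  change ((modulus (g x - f x))%:E = 0%E).
  by rewrite fgx subrr modulus0.
Qed.

(* L1 with the topology of convergence in measure, induced by the Ky Fan
   metric; see [nbhs_L1_measureP]. *)
Definition L1_measure : Type := L1.

HB.instance Definition _ := Choice.on L1_measure.

Definition dev (f g : L1) (e : R) : set T := [set x | e <= modulus (f x - g x)].

Lemma measurable_dev f g e : measurable (dev f g e).
Proof.
have := measurable_modulus (measurable_L1 (f - g)).
rewrite -[dev f g e]setTI => /(_ measurableT) /(_ `[e, +oo[%classic).
rewrite (_ : dev f g e = (fun t => modulus ((f - g) t)) @^-1` `[e, +oo[).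
  by apply; exact: measurable_itv.
by apply/seteqP; split => x /=; rewrite in_itv/= andbT.
Qed.

Definition KyFan_ball (f : L1_measure) (e : R) : set L1_measure :=
  [set g | P (dev f g e) < e%:E]%E.

Lemma KyFan_ball_center f (e : R) : 0 < e -> KyFan_ball f e f.
Proof.
rewrite /KyFan_ball/= => e0; rewrite (_ : dev f f e = set0) ?measure0//.
apply/seteqP; split => x //=.
by rewrite /dev/= subrr modulus0 leNgt e0.
Qed.

Lemma KyFan_ball_sym f g (e : R) : KyFan_ball f e g -> KyFan_ball g e f.
Proof.
rewrite /KyFan_ball/= (_ : dev g f e = dev f g e)//.
by apply/seteqP; split => x; rewrite /dev/= -modulusN opprB.
Qed.

Lemma KyFan_ball_triangle f g h (e1 e2 : R) :
  KyFan_ball f e1 g -> KyFan_ball g e2 h -> KyFan_ball f (e1 + e2) h.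
Proof.
rewrite /KyFan_ball/= => fg gh.
apply: (@le_lt_trans _ _ (P (dev f g e1 `|` dev g h e2))).
  apply: le_measure; rewrite ?inE; first exact: measurable_dev.
    by apply: measurableU; exact: measurable_dev.
  move=> x; rewrite /dev/= => fh.
  have [|fg1] := leP e1 (modulus (f x - g x)); [by left|].
  right; rewrite leNgt; apply: contraTN fh => gh2; rewrite -ltNge.
  rewrite -[f x](subrK (g x)) -addrA.
  by apply: le_lt_trans (ler_modulusD _ _) _; rewrite ltrD.
apply: le_lt_trans (measureU2 _ _ _) _; [exact: measurable_dev..|].
by rewrite EFinD; exact: lteD.
Qed.

HB.instance Definition _ :=
  hasNbhs.Build L1_measure (nbhs_ (entourage_ KyFan_ball)).
HB.instance Definition _ := @Nbhs_isPseudoMetric.Build R L1_measure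
  (entourage_ KyFan_ball) erefl KyFan_ball
  KyFan_ball_center KyFan_ball_sym KyFan_ball_triangle erefl.

Lemma nbhs_L1_measureP (f : L1_measure) (A : set L1_measure) :
  nbhs f A <-> exists e r : R, [/\ 0 < e, 0 < r &
    [set g : L1_measure |
      P [set x | (e <= modulus (f x - g x))%R] < r%:E]%E `<=` A].
Proof.
split=> [/nbhs_ballP[e /= e0 eA]|[e [r [e0 r0 erA]]]].
  by exists e, e; split.
apply/nbhs_ballP; exists (Num.min e r) => /=; first by rewrite lt_min e0.
move=> g fg; apply: erA => /=.
apply: (@le_lt_trans _ _ (P (dev f g (Num.min e r)))).
  apply: le_measure; rewrite ?inE; first exact: measurable_dev.
    exact: measurable_dev.
  by move=> x; rewrite /dev/=; apply: le_trans; rewrite ge_min lexx.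
by apply: lt_le_trans fg _; rewrite lee_fin ge_min lexx orbT.
Qed.

Definition unit_ball (X : set L1) : set L1 := [set f | X f /\ L1norm f <= 1].

Definition C_ (X : set L1) : set L1 := @closure L1_measure (unit_ball X).

End L1.

(* Main.v *)
Require Import Defs.
From mathcomp Require Import all_boot all_order all_algebra.
From mathcomp Require Import all_classical all_reals all_analysis.
From mathcomp Require Import complex measurable_realfun.
From mathcomp Require Import lra.
Import Order.TTheory GRing.Theory Num.Theory.
Import numFieldNormedType.Exports.
Local Open Scope classical_set_scope.
Local Open Scope ring_scope.

Set Implicit Arguments.
Unset Strict Implicit.
Unset Printing Implicit Defensive.

(* If x tends to f in measure with ||x|| <= 1, the difference x - f is
   asymptotically disjoint from f, so ||f - x|| <= 1 - ||f|| + o(1).  When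
   ||f|| = r > 1/2 this puts f at distance at most 1 - r + o(1) from X; choosing
   the error r - 1/2 and scaling, every f in L1 is at distance at most
   ||f|| / (2r) from X.  As 1 / (2r) < 1, iterating from f to f - x shows that
   every f is in the closure of X. *)

Section scalar.
Context {R : realType} (k : scalar_kind).

Lemma modulus_of_real (a : R) : modulus (of_real k a) = `|a|.
Proof. by case: k => //=; rewrite expr0n addr0 sqrtr_sqr. Qed.

Lemma of_realM (a b : R) : of_real k (a * b) = of_real k a * of_real k b.
Proof. by case: k => //=; exact: rmorphM. Qed.

Lemma of_real1 : of_real k (1 : R) = 1.
Proof. by case: k. Qed.

End scalar.

Section L1_geometry.
Context {R : realType} {d : measure_display} {T : measurableType d}.
Context {k : scalar_kind} {P : probability T R}.
Implicit Types f g : L1 k P.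

Lemma integrable_modulus f : P.-integrable setT (EFin \o (modulus \o f)).
Proof.
apply/integrableP; split.
  by apply/measurable_EFinP/measurable_modulus; exact: measurable_L1.
have := L1valP f; rewrite inE => -[_]; rewrite norm1E.
congr (_ < _)%E; apply: eq_integral => x _.
by rewrite gee0_abs// lee_fin modulus_ge0.
Qed.

Lemma L1normZ (c : Defs.scalar R k) f : L1norm (c *: f) = modulus c * L1norm f.
Proof.
by apply: EFin_inj; rewrite EFinM !L1normE norm1Z//; exact: measurable_L1.
Qed.

Lemma L1norm_Rintegral f : L1norm f = \int[P]_x modulus (f x).
Proof. by rewrite /L1norm norm1E. Qed.

Lemma L1norm_ge0 f : 0 <= L1norm f.
Proof. by rewrite -lee_fin L1normE norm1_ge0. Qed.

(** Integrates a pointwise bound on [|f - g| + |f|]. Where [|f - g| < e], one has [|f| <= |g| + e],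
    so the sum is at most [|g| + 2 * e]; on [dev f g e] the triangle inequality gives
    [|g| + 2 * |f|]. *)
Lemma ler_L1norm_dev f g (e : R) : 0 <= e ->
  L1norm (f - g) + L1norm f <=
  L1norm g + (2 * e + 2 * \int[P]_(x in dev f g e) modulus (f x)).
Proof.
move=> e0.
have mD := measurable_dev f g e.
have if_ := integrable_modulus f.
have ig := integrable_modulus g.
have ifg := integrable_modulus (f - g).
(* Extending by zero turns the claim into a single inequality between integrals over the whole
   space. *)
pose h := (modulus \o f) \_ (dev f g e).
have ih : P.-integrable setT (EFin \o h).
  rewrite /h -restrict_EFin; apply/(integrable_mkcond _ mD).
  by apply: integrableS if_.
have ic : P.-integrable setT (EFin \o cst (2 * e)).
  exact: finite_measure_integrable_cst.
have i2h : P.-integrable setT (EFin \o (fun x => 2 * h x)).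
  exact: (integrableZl measurableT 2 ih).
have -> : \int[P]_(x in dev f g e) modulus (f x) = \int[P]_x h x.
  exact: Rintegral_mkcond.
rewrite !L1norm_Rintegral -RintegralZl//.
have P1 : fine (P [set: T]) = 1 by rewrite probability_setT.
have -> : 2 * e = \int[P]_x cst (2 * e) x by rewrite Rintegral_cst// [fine _]P1 mulr1.
have is1 : P.-integrable setT (EFin \o (fun x => 2 * e + 2 * h x)).
  exact: (integrableD measurableT ic i2h).
rewrite -!RintegralD//; apply: le_Rintegral => //.
- exact: (integrableD measurableT ifg if_).
- exact: (integrableD measurableT ig is1).
move=> x _; rewrite /h patchE.
change ((f - g) x) with (f x - g x).
case: ifPn => [_|].
  have := ler_modulusD (f x) (- g x); rewrite modulusN /=; lra.
(* Off [dev f g e] the restriction [h] takes the default value [point], which is [0] in [R]. *)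
rewrite notin_setE /dev/= => /negP; rewrite -ltNge -[point]/(0 : R) => fg.
have := ler_modulusD (f x - g x) (g x); rewrite subrK; lra.
Qed.

(** By absolute continuity of the integral, [|f|] has small integral over [dev f x _] once [x] is
    close to [f] in measure; [ler_L1norm_dev] then applies with [L1norm x <= 1]. *)
Lemma C_approx (X : set (L1 k P)) f (e : R) : 0 < e -> C_ X f ->
  exists2 x, X x & L1norm (f - x) <= 1 - L1norm f + e.
Proof.
move=> e0 Xf.
(* Both error terms, the level and the integral over the deviation set, are doubled in
   [ler_L1norm_dev], hence the quarter. *)
have e4 : 0 < e / 4 by rewrite divr_gt0.
have [s [s0 small]] := integral_normr_continuous (integrable_modulus f) e4.
have [|x [[Xx x1] /= Px]] := Xf [set g | P (dev f g (e / 4)) < s%:E]%E.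
  by apply/nbhs_L1_measureP; exists (e / 4), s; split.
exists x => //.
have {small} := small _ (measurable_dev f x (e / 4)) Px.
under eq_Rintegral do rewrite /= ger0_norm ?modulus_ge0//.
have := ler_L1norm_dev f x (ltW e4).
lra.
Qed.

End L1_geometry.

Theorem proposition2p5 (R : realType) (k : scalar_kind)
    (d : measure_display) (Omega : measurableType d)
    (lambda : probability Omega R) (X : set (L1 k lambda)) (r : R) :
  submod_closed (mem X) -> closed X ->
  2^-1 < r ->
  [set of_real k r *: f | f in unit_ball [set: L1 k lambda]] `<=` C_ X ->
  X = [set: L1 k lambda].
Proof.
move=> [X0 Xlin] cX r2 rX.
have r0 : 0 < r by lra.
have X0' : X 0 by exact: set_mem X0.
have XL c x y : X x -> X y -> X (c *: x + y).
  by move=> Xx Xy; apply: set_mem; exact: (Xlin c x y (mem_set Xx) (mem_set Xy)).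
have XZ c x : X x -> X (c *: x) by move=> /(XL c) /(_ X0'); rewrite addr0.
have XD x y : X x -> X y -> X (x + y) by move=> /(XL 1) /[apply]; rewrite scale1r.
have approx (f : L1 k lambda) : exists2 x, X x & L1norm (f - x) <= (2 * r)^-1 * L1norm f.
  (* [L1norm] is only a seminorm on functions, so the case split is on the norm and not on
     [f = 0]. *)
  have [f0|fn0] := eqVneq (L1norm f) 0.
    by exists 0; [exact: X0'|rewrite subr0 f0 mulr0].
  have f0 : 0 < L1norm f by rewrite lt_neqAle eq_sym fn0 L1norm_ge0.
  pose g := of_real k r *: (of_real k (L1norm f)^-1 *: f).
  have gE : L1norm g = r.
    rewrite !L1normZ !modulus_of_real !gtr0_norm ?invr_gt0//.
    by rewrite mulVf// mulr1.
  have Cg : C_ X g.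
    apply: rX; exists (of_real k (L1norm f)^-1 *: f) => //; split => //.
    by rewrite L1normZ modulus_of_real gtr0_norm ?invr_gt0// mulVf.
  have er : 0 < r - 2^-1 by rewrite subr_gt0.
  (* The bound becomes [1 - r + (r - 2^-1) = 2^-1]; rescaling by [L1norm f / r] carries [g] back to
     [f]. *)
  have [x Xx] := C_approx er Cg.
  rewrite gE => gx.
  exists (of_real k (L1norm f / r) *: x); first exact: XZ.
  have -> : f - of_real k (L1norm f / r) *: x =
            of_real k (L1norm f / r) *: (g - x).
    rewrite scalerBr /g !scalerA -!of_realM.
    have -> : L1norm f / r * (r / L1norm f) = 1.
      by rewrite mulrA divfK ?gt_eqF// mulfV.
    by rewrite of_real1 scale1r.
  rewrite L1normZ modulus_of_real gtr0_norm ?divr_gt0//.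
  have -> : (2 * r)^-1 * L1norm f = L1norm f / r * 2^-1.
    by rewrite invfM mulrC [2^-1 * _]mulrC mulrA.
  rewrite ler_pM2l ?divr_gt0//; lra.
have iter n (f : L1 k lambda) :
    exists2 x, X x & L1norm (f - x) <= (2 * r)^-1 ^+ n * L1norm f.
  elim: n f => [|n IHn] f.
    by exists 0; [exact: X0'|rewrite subr0 mul1r].
  (* The residual [f - x] is approximated in turn, which gains one more factor [(2 * r)^-1]. *)
  have [x Xx fx] := IHn f; have [y Xy fxy] := approx (f - x).
  exists (x + y); first exact: XD.
  rewrite opprD addrA; apply: le_trans fxy _.
  by rewrite exprS -mulrA ler_wpM2l// invr_ge0; lra.
apply/seteqP; split => // f _; apply: cX => A /nbhs_ballP[e /= e0 eA].
have : (2 * r)^-1 ^+ n * L1norm f @[n --> \oo] --> 0.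
  rewrite -[X in _ --> X](mul0r (L1norm f)); apply: cvgMr_tmp.
  apply: cvg_expr; rewrite gtr0_norm ?invr_gt0 ?invf_lt1; lra.
move=> /cvgr0_norm_lt/(_ _ e0)[n _ /(_ n (leqnn n))/= small].
have [x Xx fx] := iter n f.
exists x; split => //; apply: eA; change (L1norm (f - x) < e).
by apply: le_lt_trans fx _; apply: le_lt_trans (ler_norm _) small.
Qed.
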